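(* Let $D\ge 1$, $\underline{\alpha}=(\alpha_1,\dots,\alpha_{D+1})$ with all $\alpha_i>0$, $\underline{\lambda}=(\lambda_1,\dots,\lambda_{D+1})$ with all $\lambda_i\ge 0$, and put $\alpha^+=\sum_{i=1}^{D+1}\alpha_i$, $\lambda^+=\sum_{i=1}^{D+1}\lambda_i$. Then the distribution $\mathrm{CNcDir}^{D}(\underline{\alpha},\underline{\lambda})$ has density on $\mathcal S^D$ given by the mixture $$\mathrm{CNcDir}^{D}(\underline{x};\underline{\alpha},\underline{\lambda})=\sum_{\underline{j}\in\mathbb N_0^{D+1}}\left[\frac{1}{{}_0F_1\left(\alpha^+;\frac{\lambda^+}{4}\right)}\,\frac{1}{(\alpha^+)_{j^+}}\prod_{i=1}^{D+1}\frac{(\lambda_i/4)^{j_i}}{j_i!}\right]\mathrm{Dir}^{D}(\underline{x};\underline{\alpha}+\underline{j}),\qquad j^+=\sum_{i=1}^{D+1}j_i ,$$ and, equivalently, for $\underline{x}\in\mathcal S^D$, $$\mathrm{CNcDir}^{D}(\underline{x};\underline{\alpha},\underline{\lambda})=\mathrm{Dir}^{D}(\underline{x};\underline{\alpha})\cdot\frac{\left[\prod_{i=1}^{D}{}_0F_1\left(\alpha_i;\frac{\lambda_i}{4}x_i\right)\right]{}_0F_1\left(\alpha_{D+1};\frac{\lambda_{D+1}}{4}\left(1-\sum_{i=1}^{D}x_i\right)\right)}{{}_0F_1\left(\alpha^+;\frac{\lambda^+}{4}\right)} .$$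
   Context: Notation: $\mathcal S^D=\{\underline{x}\in(0,1)^D:\sum_{i=1}^D x_i<1\}$. $(a)_l=\Gamma(a+l)/\Gamma(a)$ is the ascending factorial; ${}_0F_1(b;x)=\sum_{i\ge0}\frac{1}{(b)_i}\frac{x^i}{i!}$; $0^0=1$; $\mathbb N_0=\{0,1,2,\dots\}$. $\mathrm{Dir}^D(\underline{x};\underline{\alpha})=\frac{\Gamma(\alpha^+)}{\prod_{i=1}^{D+1}\Gamma(\alpha_i)}\left[\prod_{i=1}^{D}x_i^{\alpha_i-1}\right]\left(1-\sum_{i=1}^D x_i\right)^{\alpha_{D+1}-1}$ is the Dirichlet density on $\mathcal S^D$. The Non-central Chi-Squared distribution $\chi'^2_g(\lambda)$ ($g>0$, $\lambda\ge0$) has density $f_{g,\lambda}(y)=\sum_{i\ge0}\frac{e^{-\lambda/2}(\lambda/2)^i}{i!}\,\frac{y^{(g+2i)/2-1}e^{-y/2}}{\Gamma((g+2i)/2)\,2^{(g+2i)/2}}$, $y>0$. Definition: let $Y'_i\sim\chi'^2_{2\alpha_i}(\lambda_i)$, $i=1,\dots,D+1$, be independent and $Y'^+=\sum_{i=1}^{D+1}Y'_i$. $\mathrm{CNcDir}^D(\underline{\alpha},\underline{\lambda})$ is the conditional distribution of $(Y'_1/Y'^+,\dots,Y'_D/Y'^+)$ given $Y'^+=1$; concretely, the distribution on $\mathcal S^D$ whose density is proportional to $\prod_{i=1}^{D+1}f_{2\alpha_i,\lambda_i}(x_i)$ with $x_{D+1}=1-\sum_{i=1}^D x_i$. *)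

(* Defs.v *)
From HB Require Import structures.
From mathcomp Require Import all_boot all_order all_algebra.
From mathcomp Require Import all_classical all_reals all_analysis.

Set Implicit Arguments.
Unset Strict Implicit.
Unset Printing Implicit Defensive.

Import Order.TTheory GRing.Theory Num.Theory.
Import numFieldNormedType.Exports.

Local Open Scope classical_set_scope.
Local Open Scope ring_scope.

(* Lebesgue measure on R^n, where R^n is n.-tuple R with the library's product
   sigma-algebra: the unit mass on the one-point space R^0, and then the image
   of (Lebesgue measure on R) x (Lebesgue measure on R^n) under
   (x, t) |-> x :: t. *)

Section cons_measure.
Context {R : realType} {n : nat}.
Notation T := (measurableTypeR R).

Definition tuple_cons (p : T * n.-tuple T) : n.+1.-tuple T :=
  [tuple of p.1 :: p.2].

Lemma measurable_tuple_cons : measurable_fun [set: T * n.-tuple T] tuple_cons.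
Proof. exact: measurable_cons. Qed.

Definition tuple_uncons (t : n.+1.-tuple T) : T * n.-tuple T :=
  (thead t, [tuple of behead t]).

Lemma tuple_consK : cancel tuple_cons tuple_uncons.
Proof. by case=> x t; congr pair; apply: val_inj. Qed.

Lemma measurable_tuple_uncons :
  measurable_fun [set: n.+1.-tuple T] tuple_uncons.
Proof.
apply/measurable_fun_pairP; split.
  exact: measurable_tnth.
exact: measurable_behead.
Qed.

Variable m : {sigma_finite_measure set (n.-tuple T) -> \bar R}.

Definition cons_measure : set (n.+1.-tuple T) -> \bar R :=
  pushforward (lebesgue_measure \x m)%E tuple_cons.

HB.instance Definition _ := Measure.copy cons_measure
  (measure_function_pushforward__canonical__measure_function_Measure
     (lebesgue_measure \x m)%E measurable_tuple_cons).

Let cons_measure_sigma_finite : sigma_finite setT cons_measure.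
Proof.
have /sigma_finiteP[F [TF ndF Foo]] := sigma_finiteT (@lebesgue_measure R).
have /sigma_finiteP[G [TG ndG Goo]] := sigma_finiteT m.
exists (fun k => tuple_uncons @^-1` (F k `*` G k)).
  rewrite -preimage_bigcup (_ : \bigcup_i _ = setT) ?preimage_setT//.
  rewrite -setXTT TF TG predeqE => -[x t]; split=> [[k _ [? ?]]|].
    by split; exists k.
  move=> [[k _ Fx] [l _ Gt]]; exists (maxn k l) => //; split => /=.
    by move: Fx; exact/subsetPset/ndF/leq_maxl.
  by move: Gt; exact/subsetPset/ndG/leq_maxr.
move=> k; have [mF Fk] := Foo k; have [mG Gk] := Goo k; split.
  rewrite -[X in measurable X]setTI; apply: measurable_tuple_uncons => //.
  exact: measurableX.
rewrite /cons_measure /pushforward -comp_preimage.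
rewrite (_ : _ \o _ = id) ?preimage_id; last exact/funext/tuple_consK.
by rewrite product_measure1E// lte_mul_pinfty// ge0_fin_numE.
Qed.

HB.instance Definition _ := @Measure_isSigmaFinite.Build _ _ _
  cons_measure cons_measure_sigma_finite.

End cons_measure.

Fixpoint lebesgue_tuple (R : realType) (n : nat) :
    {sigma_finite_measure set (n.-tuple (measurableTypeR R)) -> \bar R} :=
  match n with
  | 0 => dirac [tuple]
  | m.+1 => cons_measure (lebesgue_tuple R m)
  end.

Section special_functions.
Context {R : realType}.

Definition Gamma (a : R) : R :=
  \int[lebesgue_measure]_(t in `]0%R, +oo[) (t `^ (a - 1) * expR (- t)).

Definition ascending_factorial (a : R) (l : nat) : R :=
  Gamma (a + l%:R) / Gamma a.

Definition hyp0F1 (b x : R) : R :=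
  limn (series (fun i => (ascending_factorial b i)^-1 * (x ^+ i / i`!%:R))).

(* Density at y > 0 of the non-central chi-squared distribution with g degrees
   of freedom and non-centrality parameter l. *)
Definition ncchi2_pdf (g l y : R) : R :=
  limn (series (fun i : nat =>
    let h := (g + 2 * i%:R) / 2 in
    expR (- (l / 2)) * (l / 2) ^+ i / i`!%:R *
    (y `^ (h - 1) * expR (- (y / 2)) / (Gamma h * 2 `^ h)))).

End special_functions.

(* The parameters with indices 1, ..., D+1 are functions on 'I_D.+1; the index
   i : 'I_D is read in 'I_D.+1 as (init_ord i), and the index D+1 is ord_max. *)
Definition init_ord (D : nat) (i : 'I_D) : 'I_D.+1 := widen_ord (leqnSn D) i.

Section dirichlet.
Context {R : realType} {D : nat}.
Implicit Types (alpha lambda : 'I_D.+1 -> R) (x : D.-tuple R).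

Definition last_coord x : R := 1 - \sum_(i < D) tnth x i.

Definition simplex : set (D.-tuple (measurableTypeR R)) :=
  [set x : D.-tuple R |
    (forall i, 0 < tnth x i < 1) /\ \sum_(i < D) tnth x i < 1].

Definition dirichlet_pdf alpha x : R :=
  Gamma (\sum_i alpha i) / (\prod_i Gamma (alpha i)) *
  (\prod_(i < D) tnth x i `^ (alpha (init_ord i) - 1)) *
  last_coord x `^ (alpha ord_max - 1).

(* Up to its normalizing constant, the conditional density of
   (Y_1 / Y^+, ..., Y_D / Y^+) given Y^+ = Y_1 + ... + Y_(D+1) = 1, where the
   Y_i are independent non-central chi-squared random variables with
   2 * alpha_i degrees of freedom and non-centrality parameters lambda_i. *)
Definition CNcDir_kernel alpha lambda x : R :=
  (\prod_(i < D)
     ncchi2_pdf (2 * alpha (init_ord i)) (lambda (init_ord i)) (tnth x i)) *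
  ncchi2_pdf (2 * alpha ord_max) (lambda ord_max) (last_coord x).

(* fine sends +oo to 0: this is a probability density exactly when the integral
   is positive and finite. *)
Definition CNcDir_pdf alpha lambda x : R :=
  CNcDir_kernel alpha lambda x /
  fine (\int[lebesgue_tuple R D]_(z in simplex)
          (CNcDir_kernel alpha lambda z)%:E)%E.

Definition CNcDir alpha lambda
    (A : set (D.-tuple (measurableTypeR R))) : \bar R :=
  (\int[lebesgue_tuple R D]_(x in A `&` simplex)
     (CNcDir_pdf alpha lambda x)%:E)%E.

Definition CNcDir_weight alpha lambda (j : {ffun 'I_D.+1 -> nat}) : R :=
  (hyp0F1 (\sum_i alpha i) ((\sum_i lambda i) / 4))^-1 *
  (ascending_factorial (\sum_i alpha i) (\sum_i j i)%N)^-1 *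
  \prod_i ((lambda i / 4) ^+ j i / (j i)`!%:R).

(* A sum of non-negative terms over all multi-indices, a priori in [0, +oo]. *)
Definition CNcDir_mixture alpha lambda x : \bar R :=
  \esum_(j in [set: {ffun 'I_D.+1 -> nat}])
    (CNcDir_weight alpha lambda j *
     dirichlet_pdf (fun i => alpha i + (j i)%:R) x)%:E.

End dirichlet.

(* Main.v *)
(* For a > 0 let g_a(x) = x^(a-1) / Gamma(a) on x > 0, and 0 elsewhere.
   Evaluating Gamma(a) Gamma(b) by Tonelli, the convolution of g_a and g_b is
   g_(a+b).  Put F_(a,l)(x) = g_a(x) 0F1(a; l x) = \sum_k l^k/k! g_(a+k)(x).
   Convolving term by term and resumming with the binomial formula, the
   convolution of F_(a,l) and F_(b,m) is F_(a+b,l+m).  The non-central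
   chi-squared density is F_(a,l/4)(x) e^(-x/2) up to a constant and the
   coordinates sum to 1, so the kernel of the density is a constant times
   \prod_i F_(a_i,l_i/4)(x_i); by induction on the dimension its mass is that
   constant times F_(a^+,l^+/4)(1) = 0F1(a^+; l^+/4) / Gamma(a^+).  The mixture
   is the product of the series of the F_(a_i,l_i/4)(x_i), expanded. *)
From HB Require Import structures.
Require Import Defs.
From mathcomp Require Import all_boot all_order all_algebra.
From mathcomp Require Import all_classical all_reals all_analysis.
From mathcomp Require Import measurable_realfun.
From mathcomp Require Import ring lra.

Set Implicit Arguments.
Unset Strict Implicit.
Unset Printing Implicit Defensive.

Import Order.TTheory GRing.Theory Num.Theory.
Import numFieldNormedType.Exports.

Local Open Scope classical_set_scope.
Local Open Scope ring_scope.

(** * Affine changes of variable for Lebesgue measure *)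

Section affine_change_of_variable.
Context {R : realType}.
Local Notation T := (measurableTypeR R).
Local Notation mu := (@lebesgue_measure R).
Local Open Scope ereal_scope.

(** Lebesgue measure is determined by its values on the intervals []a, b]], and the image measure
    gives them the same length. *)
Lemma lebesgue_measure_translate (c : R) (A : set R) : measurable A ->
  pushforward mu ((fun x => x + c)%R : T -> T) A = mu A.
Proof.
have mc : measurable_fun setT ((fun x => x + c)%R : T -> T).
  exact: measurable_funD.
pose nu := [the measure _ _ of
  measure_function_pushforward__canonical__measure_function_Measure mu mc].
move=> mA; apply/esym/(@lebesgue_measure_unique R nu) => // _ [[a b]] _ <-.
rewrite /nu /= /pushforward.
rewrite (_ : _ @^-1` _ = `]a - c, b - c]%classic)%R; last first.
  by apply/seteqP; split => x /=; rewrite !in_itv/= ltrBlDr lerBrDr.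
rewrite !lebesgue_measure_itv/= !lte_fin ltrD2r.
by case: ifPn => // _; rewrite -!EFinB opprB; congr EFin; ring.
Qed.

Lemma lebesgue_measure_scale (c : R) (A : set R) : (0 < c)%R -> measurable A ->
  c%:E * pushforward mu ((fun x => c * x)%R : T -> T) A = mu A.
Proof.
move=> c0.
have mc : measurable_fun setT ((fun x => c * x)%R : T -> T).
  exact: measurable_funM.
pose nu := [the measure _ _ of
  measure_function_pushforward__canonical__measure_function_Measure mu mc].
pose nuc := mscale (NngNum (ltW c0)) nu.
move=> mA; apply/esym/(@lebesgue_measure_unique R nuc) => // _ [[a b]] _ <-.
rewrite /nuc /= /mscale /= /pushforward.
rewrite (_ : _ @^-1` _ = `]a / c, b / c]%classic)%R; last first.
  apply/seteqP; split => x /=;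
    by rewrite !in_itv/= ltr_pdivrMr// ler_pdivlMr// mulrC.
rewrite !lebesgue_measure_itv/= !lte_fin ltr_pM2r ?invr_gt0//.
case: ifPn => // _; last by rewrite mule0.
rewrite -!EFinB -EFinM; congr EFin.
by rewrite mulrBr !(mulrC c) !divfK ?gt_eqF.
Qed.

Lemma ge0_integral_translate (f : R -> \bar R) (c : R) :
  measurable_fun setT f -> (forall x, 0 <= f x) ->
  \int[mu]_x f (x + c)%R = \int[mu]_x f x.
Proof.
move=> mf f0.
have mc : measurable_fun setT ((fun x => x + c)%R : T -> T).
  exact: measurable_funD.
transitivity (\int[pushforward mu ((fun x => x + c)%R : T -> T)]_x f x).
  by rewrite (ge0_integral_pushforward mc).
apply: eq_measure_integral => A mA _; exact: lebesgue_measure_translate.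
Qed.

Lemma ge0_integral_scale (f : R -> \bar R) (c : R) : (0 < c)%R ->
  measurable_fun setT f -> (forall x, 0 <= f x) ->
  c%:E * \int[mu]_x f (c * x)%R = \int[mu]_x f x.
Proof.
move=> c0 mf f0.
have mc : measurable_fun setT ((fun x => c * x)%R : T -> T).
  exact: measurable_funM.
pose nu := [the measure _ _ of
  measure_function_pushforward__canonical__measure_function_Measure mu mc].
transitivity (c%:E * \int[nu]_x f x).
  by rewrite (ge0_integral_pushforward mc).
rewrite -[c]/((NngNum (ltW c0))%:num)%R -ge0_integral_mscale//.
by apply: eq_measure_integral => A mA _; exact: lebesgue_measure_scale.
Qed.

End affine_change_of_variable.

(** * The Gamma function *)

Section gamma.
Context {R : realType}.
Local Notation T := (measurableTypeR R).
Local Notation mu := (@lebesgue_measure R).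
Implicit Types a b x s : R.

(** Extension by 0 lets convolutions and simplex integrals be taken over the whole space: the
    support of the integrand supplies the bounds. *)
Definition pospow a : R -> R := (fun x => x `^ (a - 1)) \_ `]0, +oo[.

Lemma pospowE a x : 0 < x -> pospow a x = x `^ (a - 1).
Proof. by move=> x0; rewrite /pospow patchE mem_set//= in_itv/= x0. Qed.

Lemma pospow_le0 a x : x <= 0 -> pospow a x = 0.
Proof.
by move=> x0; rewrite /pospow patchE memNset//= in_itv/= ltNge x0.
Qed.

Lemma pospow_ge0 a x : 0 <= pospow a x.
Proof.
by have [x0|x0] := ltP 0 x; [rewrite pospowE ?powR_ge0|rewrite pospow_le0].
Qed.

Lemma measurable_pospow a : measurable_fun setT (pospow a).
Proof.
apply/(measurable_restrictT _ _).1 => //.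
by apply: measurable_funTS; exact: measurable_powR.
Qed.

Lemma pospowM a c x : 0 < c -> pospow a (c * x) = c `^ (a - 1) * pospow a x.
Proof.
move=> c0; have [x0|x0] := ltP 0 x.
  by rewrite !pospowE ?mulr_gt0// powRM// ltW.
by rewrite !pospow_le0 ?mulr0// pmulr_rle0.
Qed.

(** For [a < 1] the integrand is singular at 0, so the interval is exhausted by [[1/(n+1), 1]].
    There the primitive [t^a / a] bounds each integral by [1/a], and monotone convergence
    concludes. *)
Lemma integral_powR_itv01_lty a : 0 < a ->
  (\int[mu]_(t in `]0%R, 1%R]) (t `^ (a - 1))%:E < +oo)%E.
Proof.
move=> a0.
pose F (n : nat) : set T := `[n.+1%:R^-1, 1%R]%classic.
have -> : `]0, 1]%classic = \bigcup_n F n.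
  apply/seteqP; split => [x|x [n _]]; rewrite /F/= !in_itv/= => /andP[x0 x1].
    have [n nx] : exists n : nat, n.+1%:R^-1 <= x.
      exists (Num.truncn x^-1); rewrite invf_ple ?posrE ?ltr0n//.
      by apply/ltW; rewrite truncnS_gt.
    by exists n => //=; rewrite in_itv/= nx.
  by rewrite x1 andbT (lt_le_trans _ x0)// invr_gt0.
have mF i : measurable (F i) by exact: measurable_itv.
have mf i : measurable_fun (F i) (fun t => (t `^ (a - 1))%:E).
  by apply/measurable_funTS/measurable_EFinP; exact: measurable_powR.
have ndF : nondecreasing_seq F.
  move=> m n mn; apply/subsetPset => x; rewrite /F/= !in_itv/= => /andP[mx ->].
  by rewrite (le_trans _ mx)// lef_pV2 ?posrE ?ltr0n// ler_nat.
apply: (@le_lt_trans _ _ (a^-1)%:E); last by rewrite ltry.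
have f0 i x : F i x -> (0 <= (x `^ (a - 1))%:E)%E by rewrite lee_fin powR_ge0.
have /cvg_lim <- // :=
  ge0_nondecreasing_set_cvg_integral ndF mF mf f0 (mu := mu).
apply: lime_le.
  apply: ereal_nondecreasing_is_cvgn.
  exact: ge0_nondecreasing_set_nondecreasing_integral.
(* For index 0 the interval is the single point 1; the fundamental theorem of calculus requires
   distinct endpoints. *)
apply: nearW => -[|n].
  by rewrite /F invr1 set_itv1 integral_set1 lee_fin invr_ge0 ltW.
have n0 : 0 < n.+2%:R^-1 :> R by rewrite invr_gt0.
have dG x : 0 < x -> is_derive x 1 (fun t : R => a^-1 * t `^ a) (x `^ (a - 1)).
  move=> x0; have := is_derive1_powR a x0.
  move=> /(@is_deriveZ _ _ _ _ a^-1).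
  by rewrite scalerA mulVf ?gt_eqF// scale1r.
have cG x : 0 < x -> {for x, continuous (fun t : R => a^-1 * t `^ a)}.
  move=> x0; have [+ _] := dG _ x0.
  by move=> /derivable1_diffP/differentiable_continuous.
rewrite /F (@continuous_FTC2 _ _ (fun t => a^-1 * t `^ a)).
- rewrite -EFinB lee_fin powR1 mulr1 gerBl mulr_ge0 ?powR_ge0//.
  by rewrite invr_ge0 ltW.
- by rewrite invf_lt1// ltr1n.
- apply: continuous_in_subspaceT => x; rewrite inE/= in_itv/= => /andP[nx _].
  have x0 : 0 < x by exact: lt_le_trans nx.
  have := @derivable_powR R 1 (a - 1) x.
  rewrite in_itv/= x0 => /(_ isT).
  by move=> /derivable1_diffP/differentiable_continuous.
- split.
  + move=> x; rewrite in_itv/= => /andP[nx _].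
    by have [] := dG _ (lt_trans n0 nx).
  + by apply: cvg_at_right_filter; exact: cG.
  + by apply: cvg_at_left_filter; exact: cG.
- move=> x; rewrite in_itv/= => /andP[nx _].
  by have [_ <-] := dG _ (lt_trans n0 nx); rewrite derive1E.
Qed.

(** Half of the exponential absorbs the power: [t^(a-1) <= t^(n+1)] for [t >= 1], and
    [(t/2)^(n+1) / (n+1)!] is a Taylor term of [expR (t / 2)]. The other half remains integrable. *)
Lemma expR_bound_pow a : exists2 C : R, 0 <= C & forall t, 1 <= t ->
  t `^ (a - 1) * expR (- t) <= C * expR (- (t / 2)).
Proof.
pose n := Num.truncn a; exists (n.+1`!%:R * 2 ^+ n.+1) => //.
move=> t t1; have t0 : 0 <= t by exact: le_trans t1.
have h : t `^ (a - 1) <= n.+1`!%:R * 2 ^+ n.+1 * expR (t / 2).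
  apply: (@le_trans _ _ (t ^+ n.+1)).
    rewrite -powR_mulrn// ler_powR// lerBlDr.
    by rewrite -natr1 ltW// ltr_wpDr// natr1 truncnS_gt.
  have h : (t / 2) ^+ n.+1 / n.+1`!%:R <= expR (t / 2).
    have := @expR_ge1Dxn R (t / 2) n (divr_ge0 t0 (ler0n _ 2)).
    by apply: le_trans; rewrite lerDr.
  rewrite ler_pdivrMr ?ltr0n ?fact_gt0// expr_div_n in h.
  rewrite ler_pdivrMr ?exprn_gt0// in h.
  by rewrite mulrC mulrA.
have -> : - t = - (t / 2) - t / 2 by lra.
by rewrite expRD mulrA ler_wpM2r ?expR_ge0// expRN ler_pdivrMr ?expR_gt0.
Qed.

Lemma measurable_pospow_expR a (D : set T) :
  measurable_fun D (fun t => (pospow a t * expR (- t))%:E).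
Proof.
apply: measurable_funTS; apply/measurable_EFinP; apply: measurable_funM.
  exact: measurable_pospow.
by apply: measurableT_comp => //; exact: measurable_expR.
Qed.

Lemma pospow_expR_ge0 a t : (0 <= (pospow a t * expR (- t))%:E)%E.
Proof. by rewrite lee_fin mulr_ge0 ?pospow_ge0 ?expR_ge0. Qed.

(** The line is cut at 0 and 1: the integrand vanishes on the left, is at most [t^(a-1)] in the
    middle, and is dominated on the right by a multiple of an exponential density. *)
Lemma integral_pospow_expR_lty a : 0 < a ->
  (\int[mu]_t (pospow a t * expR (- t))%:E < +oo)%E.
Proof.
move=> a0.
have mf := measurable_pospow_expR a.
have f0 := pospow_expR_ge0 a.
have mC : measurable (~` `]-oo, 1%R] : set T) by exact: measurableC.
rewrite -(setUv `]-oo, 1%R]) ge0_integral_setU//=; last first.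
  exact/disj_setPCl.
apply: lte_add_pinfty.
  rewrite (_ : `]-oo, 1%R]%classic = `]-oo, 0%R] `|` `]0%R, 1%R])%classic;
      last first.
    apply/seteqP; split => x /=; rewrite !in_itv/=.
      by case: (leP x 0); [left|right].
    by case=> [/le_trans->|/andP[]].
  rewrite ge0_integral_setU//=; last first.
    apply/disj_setPS => x [] /=; rewrite !in_itv/= => x0 /andP[].
    by rewrite ltNge x0.
  rewrite integral0_eq ?add0e; last first.
    by move=> x /=; rewrite in_itv/= => x0; rewrite pospow_le0// mul0r.
  apply: le_lt_trans (integral_powR_itv01_lty a0).
  apply: ge0_le_integral => //=.
    by apply/measurable_EFinP/measurable_funTS; exact: measurable_powR.
  move=> t; rewrite in_itv/= => /andP[t0 _]; rewrite lee_fin pospowE//.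
  by rewrite ler_piMr ?powR_ge0// expR_le1 oppr_le0 ltW.
have [C C0 hC] := expR_bound_pow a.
(* The factor 2 cancels the rate [1/2] in front of the exponential density. *)
pose g (t : R) := ((2 * C)%:E * (exponential_pdf 2^-1 t)%:E)%E.
apply: (@le_lt_trans _ _ (\int[mu]_t g t)%E).
  apply: (@le_trans _ _ (\int[mu]_(t in ~` `]-oo, 1%R]) g t)%E).
    apply: ge0_le_integral => //=.
    - apply: measurable_funeM; apply/measurable_EFinP/measurable_funTS.
      exact: measurable_exponential_pdf.
    move=> t /=; rewrite in_itv/= => /negP; rewrite -ltNge => t1.
    have t0 : 0 < t by exact: lt_trans t1.
    rewrite /g -EFinM lee_fin pospowE// (le_trans (hC _ (ltW t1)))//.
    rewrite exponential_pdfE ?(ltW t0)// mulrACA divff// mul1r.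
    by rewrite mulNr [t / 2]mulrC.
  apply: ge0_subset_integral => //=.
  - apply: measurable_funeM; apply/measurable_EFinP.
    exact: measurable_exponential_pdf.
  - by move=> x _; rewrite /g -EFinM lee_fin !mulr_ge0// exponential_pdf_ge0.
rewrite ge0_integralZl//=.
- by rewrite integral_exponential_pdf// mule1 ltry.
- by apply/measurable_EFinP; exact: measurable_exponential_pdf.
- by move=> x _; rewrite lee_fin exponential_pdf_ge0.
- by rewrite lee_fin mulr_ge0.
Qed.

(** [Gamma] is a real-valued integral, hence a [fine]; finiteness is what makes it agree with the
    extended integral. *)
Lemma integral_pospow_expR a : 0 < a ->
  (\int[mu]_t (pospow a t * expR (- t))%:E = (Gamma a)%:E)%E.
Proof.
move=> a0; rewrite /Gamma /Rintegral integral_mkcond.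
rewrite -[LHS]fineK; last first.
  rewrite ge0_fin_numE ?integral_pospow_expR_lty//.
  by apply: integral_ge0 => t _; exact: pospow_expR_ge0.
congr (fine _)%:E; apply: eq_integral => t _.
rewrite /pospow !patchE; case: ifP => // _.
by rewrite mul0r.
Qed.

(** On [[1, 2]] one has [t^(a-1) >= 1/t >= 1/2] and [expR (- t) >= expR (- 2)]. The bound is uniform
    in [a], so it also controls all the values [Gamma (a + i)] in the series of [hyp0F1]. *)
Lemma Gamma_ge a : 0 < a -> expR (- 2) / 2 <= Gamma a.
Proof.
move=> a0; rewrite -lee_fin -integral_pospow_expR//.
apply: (@le_trans _ _ (\int[mu]_(t in `[1%R, 2%R]) (expR (- 2) / 2)%:E)%E).
  rewrite integral_cst//= lebesgue_measure_itv/= lte_fin ltr1n -EFinB -EFinM.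
  by rewrite lee_fin; lra.
apply: (@le_trans _ _
  (\int[mu]_(t in `[1%R, 2%R]) (pospow a t * expR (- t))%:E)%E).
  apply: ge0_le_integral => //=; first exact: measurable_pospow_expR.
  move=> t; rewrite in_itv/= => /andP[t1 t2].
  have t0 : 0 < t by exact: lt_le_trans t1.
  rewrite lee_fin pospowE// mulrC ler_pM ?invr_ge0 ?expR_ge0//; last first.
    by rewrite ler_expR lerN2.
  apply: (@le_trans _ _ (t `^ (- 1))).
    by rewrite powR_inv1 ?(ltW t0)// lef_pV2 ?posrE.
  by apply: ler_powR => //; rewrite lerDr (ltW a0).
apply: ge0_subset_integral => //=.
- exact: measurable_pospow_expR.
- by move=> t _; exact: pospow_expR_ge0.
Qed.

Lemma Gamma_gt0 a : 0 < a -> 0 < Gamma a.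
Proof. by move=> /Gamma_ge; apply: lt_le_trans; rewrite divr_gt0 ?expR_gt0. Qed.

End gamma.

(** * Convolution of normalized powers *)

Section dirichlet_kernel.
Context {R : realType}.
Local Notation T := (measurableTypeR R).
Local Notation mu := (@lebesgue_measure R).
Implicit Types a b x s : R.

Let conv a b s : \bar R :=
  (\int[mu]_x (pospow a x * pospow b (s - x))%:E)%E.

Lemma measurable_pospow_conv a b s (D : set T) :
  measurable_fun D (fun x => (pospow a x * pospow b (s - x))%:E).
Proof.
apply: measurable_funTS; apply/measurable_EFinP; apply: measurable_funM.
  exact: measurable_pospow.
apply: measurableT_comp; first exact: measurable_pospow.
exact: measurable_funB.
Qed.

Let conv_ge0 a b s x : (0 <= (pospow a x * pospow b (s - x))%:E)%E.
Proof. by rewrite lee_fin mulr_ge0 ?pospow_ge0. Qed.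

(** The substitution of [s * x] for [x] extracts [s^(a-1)], [s^(b-1)] and the Jacobian [s]. For
    [s <= 0] the two factors are never both nonzero. *)
Lemma integral_pospow_conv_homogeneous a b s :
  (\int[mu]_x (pospow a x * pospow b (s - x))%:E =
   (pospow (a + b) s)%:E * \int[mu]_x (pospow a x * pospow b (1 - x))%:E)%E.
Proof.
have [s0|s0] := ltP 0 s; last first.
  rewrite (pospow_le0 _ s0) mul0e integral0_eq// => x _.
  have [x0|x0] := ltP 0 x; last by rewrite (pospow_le0 _ x0) mul0r.
  by rewrite (@pospow_le0 _ b) ?mulr0// subr_le0 (le_trans s0)// ltW.
have /= <- := ge0_integral_scale s0 (@measurable_pospow_conv a b s setT)
  (conv_ge0 a b s).
rewrite (pospowE _ s0).
have powD (r t : R) : s `^ (r + t) = s `^ r * s `^ t.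
  by rewrite powRD// (gt_eqF s0) implybT.
have -> : s `^ (a + b - 1) = s * (s `^ (a - 1) * s `^ (b - 1)).
  by rewrite -powD -[X in X * _](powRr1 (ltW s0)) -powD; congr (_ `^ _); ring.
rewrite [in RHS]EFinM -muleA; congr (_ * _)%E.
rewrite -ge0_integralZl//.
- apply: eq_integral => x _.
  by rewrite -[X in X - _]mulr1 -mulrBr !pospowM// -EFinM mulrACA.
- exact: measurable_pospow_conv.
- by rewrite lee_fin mulr_ge0 ?powR_ge0.
Qed.

(** Euler's formula for the Beta integral. The product is a double integral in which the second
    variable is shifted to become the sum [s]; after Tonelli the exponentials combine into
    [expR (- s)], and homogeneity separates [s] from the Beta integral. *)
Lemma Gamma_mul a b : 0 < a -> 0 < b ->
  ((Gamma a * Gamma b)%:E =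
   (Gamma (a + b))%:E * \int[mu]_x (pospow a x * pospow b (1 - x))%:E)%E.
Proof.
move=> a0 b0.
pose f (p : T * T) := ((pospow a p.1 * expR (- p.1)) *
  (pospow b (p.2 - p.1) * expR (- (p.2 - p.1))))%:E.
have mf : measurable_fun setT f.
  apply/measurable_EFinP; apply: measurable_funM; apply: measurable_funM.
  - by apply: measurableT_comp => //; exact: measurable_pospow.
  - apply: measurableT_comp; first exact: measurable_expR.
    exact: measurableT_comp.
  - apply: measurableT_comp; first exact: measurable_pospow.
    exact: measurable_funB.
  - apply: measurableT_comp; first exact: measurable_expR.
    by apply: measurableT_comp => //; exact: measurable_funB.
have f0 p : (0 <= f p)%E by rewrite lee_fin !mulr_ge0 ?pospow_ge0 ?expR_ge0.
transitivity (\int[mu]_x \int[mu]_s f (x, s))%E.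
  rewrite EFinM -(integral_pospow_expR a0).
  rewrite -ge0_integralZr//; last 3 first.
  - exact: measurable_pospow_expR.
  - by move=> x _; exact: pospow_expR_ge0.
  - by rewrite lee_fin ltW// Gamma_gt0.
  apply: eq_integral => x _.
  rewrite -(integral_pospow_expR b0).
  have /= <- := ge0_integral_translate (- x)
    (@measurable_pospow_expR R b setT) (pospow_expR_ge0 b).
  rewrite -ge0_integralZl//.
  - apply: (measurableT_comp (@measurable_pospow_expR R b setT)).
    exact: measurable_funD.
  - by move=> t _; exact: pospow_expR_ge0.
  - exact: pospow_expR_ge0.
rewrite (fubini_tonelli f mf f0).
rewrite -integral_pospow_expR ?addr_gt0//.
rewrite -ge0_integralZr//; last 3 first.
- exact: measurable_pospow_expR.
- by move=> x _; exact: pospow_expR_ge0.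
- by apply: integral_ge0 => x _; exact: conv_ge0.
apply: eq_integral => s _.
rewrite EFinM muleAC -integral_pospow_conv_homogeneous muleC.
rewrite -ge0_integralZl//; last exact: measurable_pospow_conv.
apply: eq_integral => x _; rewrite /f/= -EFinM; congr EFin.
rewrite mulrACA -expRD mulrC; congr (expR _ * _).
by ring.
Qed.

(** The Riemann-Liouville kernel of fractional integration, that is, the gamma density without its
    exponential factor. *)
Definition gpow a x : R := pospow a x / Gamma a.

Lemma gpow_ge0 a x : 0 < a -> 0 <= gpow a x.
Proof. by move=> a0; rewrite divr_ge0 ?pospow_ge0 ?ltW ?Gamma_gt0. Qed.

Lemma gpow_gt0 a x : 0 < a -> 0 < x -> 0 < gpow a x.
Proof. by move=> a0 x0; rewrite divr_gt0 ?Gamma_gt0// pospowE// powR_gt0. Qed.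

Lemma gpow_le0 a x : x <= 0 -> gpow a x = 0.
Proof. by move=> x0; rewrite /gpow pospow_le0// mul0r. Qed.

Lemma measurable_gpow a : measurable_fun setT (gpow a).
Proof. by apply: measurable_funM => //; exact: measurable_pospow. Qed.

(** The semigroup law: by homogeneity only the constant at [s = 1] matters, and [Gamma_mul] shows
    that the normalization cancels it. *)
Lemma integral_gpow_conv a b s : 0 < a -> 0 < b ->
  (\int[mu]_x (gpow a x * gpow b (s - x))%:E = (gpow (a + b) s)%:E)%E.
Proof.
move=> a0 b0.
have Ga := Gamma_gt0 a0; have Gb := Gamma_gt0 b0.
have Gab := Gamma_gt0 (addr_gt0 a0 b0).
transitivity (((Gamma a * Gamma b)^-1)%:E * conv a b s)%E.
  rewrite -ge0_integralZl//.
  - apply: eq_integral => x _; rewrite -EFinM; congr EFin.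
    by rewrite /gpow mulrACA -invfM mulrC.
  - exact: measurable_pospow_conv.
  - by rewrite lee_fin invr_ge0 (mulr_ge0 (ltW Ga) (ltW Gb)).
have h : (conv a b 1 = ((Gamma a * Gamma b) / Gamma (a + b))%:E)%E.
  rewrite mulrC EFinM Gamma_mul// muleA -EFinM mulVf ?mul1e//.
  exact: lt0r_neq0 Gab.
rewrite /conv integral_pospow_conv_homogeneous -/(conv a b 1) h -!EFinM.
congr EFin; rewrite /gpow mulrCA (mulrA _^-1) mulVf ?mul1r//.
exact: lt0r_neq0 (mulr_gt0 Ga Gb).
Qed.

End dirichlet_kernel.

(** * Series and non-central densities *)

Section nonneg_series.
Context {R : realType}.
Local Open Scope ereal_scope.

Lemma nneseries_EFin (u : nat -> R) : cvgn (series u) ->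
  \sum_(i <oo) (u i)%:E = (limn (series u))%:E.
Proof.
move=> cu; rewrite -EFin_lim//; congr (limn _); apply/funext => n /=.
by rewrite sumEFin.
Qed.

(** Nonnegative terms may be regrouped along the diagonals [k + j = n], and each diagonal is a
    binomial expansion. *)
Lemma exp_series_convolution (l m : R) (c : nat -> R) :
  (0 <= l)%R -> (0 <= m)%R -> (forall n, 0 <= c n)%R ->
  \sum_(k <oo) \sum_(j <oo)
    (l ^+ k / k`!%:R * (m ^+ j / j`!%:R) * c (k + j)%N)%:E =
  \sum_(n <oo) ((l + m) ^+ n / n`!%:R * c n)%:E.
Proof.
move=> l0 m0 c0.
pose b n k : \bar R :=
  (l ^+ k / k`!%:R * (m ^+ (n - k) / (n - k)`!%:R) * c n)%:E.
have b0 n k : 0 <= b n k.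
  by rewrite lee_fin !mulr_ge0 ?invr_ge0 ?exprn_ge0.
have a0 k j : 0 <= (l ^+ k / k`!%:R * (m ^+ j / j`!%:R) * c (k + j)%N)%:E.
  by have := b0 (k + j)%N k; rewrite /b addKn.
transitivity (\esum_(n in [set: nat]) \esum_(k in `I_n.+1) b n k); last first.
  rewrite nneseries_esumT; last first.
    by move=> n; rewrite lee_fin !mulr_ge0 ?invr_ge0 ?exprn_ge0 ?addr_ge0.
  apply: eq_esum => n _.
  rewrite esum_fset; [|exact: finite_II|by []]. rewrite -fsbig_ord.
  rewrite /b sumEFin -mulr_suml; congr (_ * _)%:E.
  rewrite addrC exprDn mulr_suml; apply: eq_bigr => k _.
  rewrite -mulr_natl.
  have -> : (n`! = 'C(n, k) * (k`! * (n - k)`!))%N by rewrite bin_fact// -ltnS.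
  rewrite !natrM.
  have h1 : (k`!%:R != 0 :> R)%R by rewrite pnatr_eq0 -lt0n fact_gt0.
  have h2 : ((n - k)`!%:R != 0 :> R)%R by rewrite pnatr_eq0 -lt0n fact_gt0.
  have h3 : ('C(n, k)%:R != 0 :> R)%R.
    by rewrite pnatr_eq0 -lt0n bin_gt0 -ltnS.
  by field; rewrite h1 h2 h3.
transitivity (\esum_(k in [set: nat]) \esum_(j in [set: nat])
    (l ^+ k / k`!%:R * (m ^+ j / j`!%:R) * c (k + j)%N)%:E).
  rewrite nneseries_esumT; last by move=> k; exact: nneseries_ge0.
  by apply: eq_esum => k _; rewrite nneseries_esumT.
rewrite !esum_esum//.
(* The map from [(k, j)] to [(k + j, k)] is a bijection onto the pairs [(n, k)] with [k <= n]. *)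
rewrite [RHS](reindex_esum ([set: nat] `*`` (fun=> [set: nat])) _
  (fun p : nat * nat => ((p.1 + p.2)%N, p.1))).
  by apply: eq_esum => -[k j] _ /=; rewrite /b addKn.
split => //=.
- by move=> [k j] _ /=; split => //=; rewrite ltnS leq_addr.
- move=> [k j] [k' j'] _ _ /= [+ kk']; rewrite kk' => /addnI ->.
  by [].
- move=> [n k] [_ /=]; rewrite ltnS => kn; exists (k, (n - k)%N) => //=.
  by rewrite subnKC.
Qed.

End nonneg_series.

(** * The non-central kernel: convergence, series and convolution *)

Section noncentral_kernel.
Context {R : realType}.
Local Notation T := (measurableTypeR R).
Local Notation mu := (@lebesgue_measure R).
Implicit Types a b l m x s : R.

Lemma ascending_factorial_gt0 a n : 0 < a -> 0 < ascending_factorial a n.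
Proof. by move=> a0; rewrite divr_gt0 ?Gamma_gt0// ltr_wpDr. Qed.

Lemma ascending_factorial0 a : 0 < a -> ascending_factorial a 0 = 1.
Proof.
by move=> a0; rewrite /ascending_factorial addr0 divff// gt_eqF// Gamma_gt0.
Qed.

Let hyp0F1_term_ge0 a x i : 0 < a -> 0 <= x ->
  0 <= (ascending_factorial a i)^-1 * (x ^+ i / i`!%:R).
Proof.
move=> a0 x0; rewrite mulr_ge0 ?invr_ge0 ?(ltW (ascending_factorial_gt0 _ _))//.
by rewrite divr_ge0 ?exprn_ge0.
Qed.

(* [Gamma] is bounded below by [expR (- 2) / 2] uniformly on the positive
   half-line, so the exponential series dominates. *)
Lemma is_cvg_series_hyp0F1 a x : 0 < a -> 0 <= x ->
  cvgn (series (fun i => (ascending_factorial a i)^-1 * (x ^+ i / i`!%:R))).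
Proof.
move=> a0 x0; pose C := Gamma a / (expR (- 2) / 2).
have e0 : 0 < expR (- 2) / 2 :> R by rewrite divr_gt0 ?expR_gt0.
have C0 : 0 <= C by rewrite (divr_ge0 (ltW (Gamma_gt0 a0)) (ltW e0)).
apply: (@series_le_cvg _ _ (C *: exp_coeff x)).
- by move=> n; exact: hyp0F1_term_ge0.
- by move=> n; rewrite mulr_ge0// exp_coeff_ge0.
- move=> n; rewrite ler_wpM2r ?divr_ge0 ?exprn_ge0//.
  rewrite /ascending_factorial invf_div ler_wpM2l ?(ltW (Gamma_gt0 a0))//.
  by rewrite lef_pV2 ?posrE ?Gamma_gt0 ?Gamma_ge// ltr_wpDr.
- by apply: is_cvg_seriesZ; exact: is_cvg_series_exp_coeff.
Qed.

Lemma nneseries_hyp0F1 a x : 0 < a -> 0 <= x ->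
  (\sum_(i <oo) ((ascending_factorial a i)^-1 * (x ^+ i / i`!%:R))%:E =
   (hyp0F1 a x)%:E)%E.
Proof. by move=> a0 x0; exact/nneseries_EFin/is_cvg_series_hyp0F1. Qed.

(** All terms are nonnegative and the one of index 0 equals 1. *)
Lemma hyp0F1_gt0 a x : 0 < a -> 0 <= x -> 0 < hyp0F1 a x.
Proof.
move=> a0 x0; apply: (@lt_le_trans _ _ 1) => //.
rewrite -lee_fin -nneseries_hyp0F1//.
apply: (@le_trans _ _ (\sum_(0 <= i < 1)
    ((ascending_factorial a i)^-1 * (x ^+ i / i`!%:R))%:E))%E.
  by rewrite big_nat1 ascending_factorial0// invr1 mul1r expr0 mulr1.
by apply: nneseries_lim_ge => i _; rewrite lee_fin hyp0F1_term_ge0.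
Qed.

(* Up to the factor [expR (- x / 2)] and a constant, the density at [x] of the
   non-central chi-squared distribution with [2 * a] degrees of freedom and
   non-centrality parameter [4 * l]. *)
Definition ncgpow a l x : R := gpow a x * hyp0F1 a (l * x).

Lemma ncgpow_gt0 a l x : 0 < a -> 0 <= l -> 0 < x -> 0 < ncgpow a l x.
Proof.
by move=> a0 l0 x0; rewrite mulr_gt0 ?gpow_gt0 ?hyp0F1_gt0// mulr_ge0// ltW.
Qed.

Lemma ncgpow_le0 a l x : x <= 0 -> ncgpow a l x = 0.
Proof. by move=> x0; rewrite /ncgpow gpow_le0// mul0r. Qed.

Lemma ncgpow_ge0 a l x : 0 < a -> 0 <= l -> 0 <= ncgpow a l x.
Proof.
move=> a0 l0; have [x0|x0] := ltP 0 x; last by rewrite ncgpow_le0.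
exact/ltW/ncgpow_gt0.
Qed.

(** This shift of the parameter absorbs the [k]-th factor of a [hyp0F1] series into the power, so
    that convolution can be done term by term. *)
Lemma gpow_addn a x k : 0 < a ->
  gpow (a + k%:R) x = gpow a x * ((ascending_factorial a k)^-1 * x ^+ k).
Proof.
move=> a0; have [x0|x0] := ltP 0 x; last by rewrite !gpow_le0// mul0r.
rewrite /gpow /ascending_factorial !pospowE// invf_div.
have -> : x `^ (a + k%:R - 1) = x `^ (a - 1) * x ^+ k.
  rewrite -powR_mulrn ?(ltW x0)// -powRD ?(gt_eqF x0) ?implybT//.
  by congr (_ `^ _); ring.
have := lt0r_neq0 (Gamma_gt0 a0).
move: (Gamma a) (Gamma (a + k%:R)) => G Gk G0.
by rewrite -!mulrA (mulrA G^-1) mulVf// mul1r [Gk^-1 * _]mulrC.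
Qed.

Lemma ncgpow_series a l x : 0 < a -> 0 <= l ->
  ((ncgpow a l x)%:E =
   \sum_(k <oo) (l ^+ k / k`!%:R * gpow (a + k%:R) x)%:E)%E.
Proof.
(* For [x <= 0] the argument of [hyp0F1] leaves the range where its convergence was shown, but the
   factor [gpow] makes both sides vanish. *)
move=> a0 l0; have [x0|x0] := ltP 0 x; last first.
  rewrite ncgpow_le0// eseries0// => k _ _.
  by rewrite gpow_le0// mulr0.
have lx0 : 0 <= l * x by rewrite mulr_ge0// ltW.
rewrite /ncgpow EFinM -nneseries_hyp0F1// -nneseriesZl; last first.
  by move=> i _; rewrite lee_fin hyp0F1_term_ge0.
apply: eq_eseriesr => k _; rewrite -EFinM gpow_addn//; congr EFin.
by rewrite exprMn; ring.
Qed.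

Let ncgpow_series_ge0 a l x k : 0 < a -> 0 <= l ->
  0 <= l ^+ k / k`!%:R * gpow (a + k%:R) x.
Proof.
move=> a0 l0; rewrite mulr_ge0 ?gpow_ge0 ?divr_ge0 ?exprn_ge0//.
by rewrite ltr_wpDr.
Qed.

(** Measurability is read off the expansion as a countable sum of nonnegative measurable
    functions. *)
Lemma measurable_ncgpow a l : 0 < a -> 0 <= l ->
  measurable_fun setT (ncgpow a l).
Proof.
move=> a0 l0; apply/measurable_EFinP.
rewrite [X in measurable_fun _ X](_ : _ = fun x => (\sum_(k <oo)
    (l ^+ k / k`!%:R * gpow (a + k%:R) x)%:E)%E); last first.
  by apply/funext => x /=; exact: ncgpow_series.
apply: (@ge0_emeasurable_sum _ _ _ _ (fun k x => _) xpredT).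
  by move=> k x _ _; rewrite lee_fin ncgpow_series_ge0.
move=> k _; apply/measurable_EFinP; apply: measurable_funM => //.
exact: measurable_gpow.
Qed.

(** The half-expanded case: only the second factor is a series, which is integrated term by term
    with the semigroup law. *)
Lemma integral_gpow_ncgpow_conv a b m s : 0 < a -> 0 < b -> 0 <= m ->
  (\int[mu]_x (gpow a x * ncgpow b m (s - x))%:E =
   \sum_(j <oo) (m ^+ j / j`!%:R * gpow (a + b + j%:R) s)%:E)%E.
Proof.
move=> a0 b0 m0.
pose f j x : \bar R :=
  (gpow a x * (m ^+ j / j`!%:R * gpow (b + j%:R) (s - x)))%:E.
have mB j : measurable_fun setT (fun x : T => gpow (b + j%:R) (s - x)).
  by apply: measurableT_comp; [exact: measurable_gpow|exact: measurable_funB].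
transitivity (\int[mu]_x \sum_(j <oo) f j x)%E.
  apply: eq_integral => x _; rewrite EFinM ncgpow_series// -nneseriesZl//.
  by move=> j _; rewrite lee_fin ncgpow_series_ge0.
rewrite integral_nneseries//; last 2 first.
- move=> j; apply/measurable_EFinP; apply: measurable_funM.
    exact: measurable_gpow.
  exact: measurable_funM.
- by move=> j x _; rewrite lee_fin mulr_ge0 ?gpow_ge0 ?ncgpow_series_ge0.
apply: eq_eseriesr => j _.
rewrite EFinM -addrA -integral_gpow_conv ?ltr_wpDr// -ge0_integralZl//.
- by apply: eq_integral => x _; rewrite -EFinM /f mulrCA.
- apply/measurable_EFinP; apply: measurable_funM => //.
  exact: measurable_gpow.
- by move=> x _; rewrite lee_fin mulr_ge0 ?gpow_ge0// ltr_wpDr.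
- by rewrite lee_fin divr_ge0 ?exprn_ge0.
Qed.

(** Expanding the first factor as well gives a double series whose power [gpow] depends on [k] and
    [j] only through [k + j], so [exp_series_convolution] resums it. *)
Lemma integral_ncgpow_conv a b l m s : 0 < a -> 0 < b -> 0 <= l -> 0 <= m ->
  (\int[mu]_x (ncgpow a l x * ncgpow b m (s - x))%:E =
   (ncgpow (a + b) (l + m) s)%:E)%E.
Proof.
move=> a0 b0 l0 m0.
pose f k x : \bar R :=
  (ncgpow b m (s - x) * (l ^+ k / k`!%:R * gpow (a + k%:R) x))%:E.
have mB : measurable_fun setT (fun x : T => ncgpow b m (s - x)).
  by apply: measurableT_comp; [exact: measurable_ncgpow|exact: measurable_funB].
transitivity (\int[mu]_x \sum_(k <oo) f k x)%E.
  apply: eq_integral => x _.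
  rewrite mulrC EFinM (ncgpow_series x a0 l0) -nneseriesZl//.
  by move=> k _; rewrite lee_fin ncgpow_series_ge0.
rewrite integral_nneseries//; last 2 first.
- move=> k; apply/measurable_EFinP; apply: measurable_funM => //.
  by apply: measurable_funM => //; exact: measurable_gpow.
- by move=> k x _; rewrite lee_fin mulr_ge0 ?ncgpow_ge0 ?ncgpow_series_ge0.
rewrite ncgpow_series ?addr_gt0 ?addr_ge0//.
rewrite -(@exp_series_convolution _ _ _ (fun n => gpow (a + b + n%:R) s))//;
    last first.
  by move=> n; rewrite gpow_ge0// ltr_wpDr// addr_gt0.
apply: eq_eseriesr => k _.
transitivity ((l ^+ k / k`!%:R)%:E *
    \int[mu]_x (gpow (a + k%:R) x * ncgpow b m (s - x))%:E)%E.
  rewrite -ge0_integralZl//.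
  - by apply: eq_integral => x _; rewrite -EFinM /f mulrC -!mulrA.
  - apply/measurable_EFinP; apply: measurable_funM => //.
    exact: measurable_gpow.
  - by move=> x _; rewrite lee_fin mulr_ge0 ?ncgpow_ge0 ?gpow_ge0// ltr_wpDr.
  - by rewrite lee_fin divr_ge0 ?exprn_ge0.
rewrite integral_gpow_ncgpow_conv ?ltr_wpDr// -nneseriesZl; last first.
  move=> j _; rewrite lee_fin mulr_ge0 ?gpow_ge0 ?divr_ge0 ?exprn_ge0//.
  by rewrite ltr_wpDr// addr_gt0// ltr_wpDr.
apply: eq_eseriesr => j _; rewrite -EFinM; congr EFin.
have -> : a + k%:R + b + j%:R = a + b + (k + j)%N%:R by rewrite natrD; ring.
by rewrite !mulrA.
Qed.

End noncentral_kernel.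

(** * Integration over the simplex *)

Section simplex_integral.
Context {R : realType}.
Local Notation T := (measurableTypeR R).
Local Notation mu := (@lebesgue_measure R).

(** The total [s] is left free for the induction on the dimension: removing a first coordinate [x]
    changes it to [s - x]. *)
Definition simplex_kernel n (alpha lambda : 'I_n.+1 -> R) (s : R)
    (x : n.-tuple R) : R :=
  (\prod_(i < n) ncgpow (alpha (init_ord i)) (lambda (init_ord i)) (tnth x i)) *
  ncgpow (alpha ord_max) (lambda ord_max) (s - \sum_(i < n) tnth x i).

Lemma simplex_kernel_ge0 n (alpha lambda : 'I_n.+1 -> R) s x :
  (forall i, 0 < alpha i) -> (forall i, 0 <= lambda i) ->
  0 <= simplex_kernel alpha lambda s x.
Proof.
move=> a0 l0; rewrite mulr_ge0 ?ncgpow_ge0// prodr_ge0// => i _.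
exact: ncgpow_ge0.
Qed.

Lemma measurable_simplex_kernel n (alpha lambda : 'I_n.+1 -> R) s :
  (forall i, 0 < alpha i) -> (forall i, 0 <= lambda i) ->
  measurable_fun [set: n.-tuple T] (simplex_kernel alpha lambda s).
Proof.
move=> a0 l0; apply: measurable_funM.
  apply: measurable_prod => i _.
  apply: measurableT_comp; first exact: measurable_ncgpow.
  exact: measurable_tnth.
apply: measurableT_comp; first exact: measurable_ncgpow.
apply: measurable_funB => //.
apply: measurable_sum => i; exact: measurable_tnth.
Qed.

Lemma integral_cons_measure n
    (m : {sigma_finite_measure set (n.-tuple T) -> \bar R})
    (f : n.+1.-tuple T -> \bar R) :
  measurable_fun setT f -> (forall x, 0 <= f x)%E ->
  (\int[cons_measure m]_x f x = \int[mu]_x \int[m]_t f (tuple_cons (x, t)))%E.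
Proof.
move=> mf f0.
transitivity (\int[(mu \x m)%E]_p (f \o tuple_cons) p)%E.
  exact: (ge0_integral_pushforward measurable_tuple_cons).
rewrite (fubini_tonelli1 (f \o tuple_cons))//; last by move=> p; exact: f0.
apply: measurableT_comp => //; exact: measurable_tuple_cons.
Qed.

Lemma simplex_kernel_cons n (alpha lambda : 'I_n.+2 -> R) s x (t : n.-tuple R) :
  simplex_kernel alpha lambda s (tuple_cons (x, t)) =
  ncgpow (alpha ord0) (lambda ord0) x *
  simplex_kernel (alpha \o lift ord0) (lambda \o lift ord0) (s - x) t.
Proof.
have e0 : init_ord (ord0 : 'I_n.+1) = ord0 by exact: val_inj.
have eS (i : 'I_n) : init_ord (lift ord0 i) = lift ord0 (init_ord i).
  exact: val_inj.
have em : lift ord0 (ord_max : 'I_n.+1) = ord_max by exact: val_inj.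
have tS (i : 'I_n) : tnth (tuple_cons (x, t)) (lift ord0 i) = tnth t i.
  by rewrite !(tnth_nth 0).
have t0 : tnth (tuple_cons (x, t)) ord0 = x by [].
rewrite /simplex_kernel !big_ord_recl e0 t0 -mulrA opprD addrA /= em.
congr (_ * (_ * _)).
  by apply: eq_bigr => i _; rewrite eS tS.
by congr (ncgpow _ _ (_ - _)); apply: eq_bigr => i _; rewrite tS.
Qed.

(** An iterated convolution: the tail is integrated first, by the induction hypothesis with total
    [s - x], and the first coordinate then by [integral_ncgpow_conv]. *)
Lemma integral_simplex_kernel n (alpha lambda : 'I_n.+1 -> R) s :
  (forall i, 0 < alpha i) -> (forall i, 0 <= lambda i) ->
  (\int[lebesgue_tuple R n]_x (simplex_kernel alpha lambda s x)%:E =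
   (ncgpow (\sum_i alpha i) (\sum_i lambda i) s)%:E)%E.
Proof.
elim: n alpha lambda s => [|n IHn] alpha lambda s a0 l0.
  have mk := measurable_simplex_kernel s a0 l0.
  (* In dimension 0 the measure is the unit mass at the empty tuple, so integration is
     evaluation. *)
  transitivity ((simplex_kernel alpha lambda s [tuple])%:E).
    rewrite [LHS](integral_dirac [tuple])//= ?diracT ?mul1e//.
    exact/measurable_EFinP.
  rewrite /simplex_kernel !big_ord0 mul1r subr0 !big_ord_recl !big_ord0 !addr0.
  by rewrite (_ : ord_max = ord0)//; exact: val_inj.
have a0' i : 0 < (alpha \o lift ord0) i by exact: a0.
have l0' i : 0 <= (lambda \o lift ord0) i by exact: l0.
rewrite [LHS](@integral_cons_measure n (lebesgue_tuple R n)); last 2 first.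
- by apply/measurable_EFinP; exact: measurable_simplex_kernel.
- by move=> x; rewrite lee_fin simplex_kernel_ge0.
rewrite [\sum_i alpha i]big_ord_recl [\sum_i lambda i]big_ord_recl
  -(integral_ncgpow_conv _ (a0 ord0))//; last 2 first.
- by rewrite big_ord_recl ltr_wpDr// sumr_ge0// => i _; exact/ltW/a0.
- by rewrite sumr_ge0.
apply: eq_integral => x _.
under eq_integral do rewrite simplex_kernel_cons EFinM.
rewrite ge0_integralZl//.
- by rewrite IHn.
- by apply/measurable_EFinP; exact: measurable_simplex_kernel.
- by move=> t _; rewrite lee_fin simplex_kernel_ge0.
- by rewrite lee_fin ncgpow_ge0.
Qed.

End simplex_integral.

(** * Products of series *)

Section esum_product.
Context {R : realType}.
Local Open Scope ereal_scope.

Lemma ge0_esumZl (I : choiceType) (D : set I) (c : R) (a : I -> \bar R) :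
  (0 <= c)%R -> (forall i, 0 <= a i) ->
  \esum_(i in D) (c%:E * a i) = c%:E * \esum_(i in D) a i.
Proof.
move=> c0 a0.
(* One inequality, from finite partial sums, suffices: applied to [c^-1] it yields the converse. *)
have ub (r : R) (b : I -> \bar R) : (0 <= r)%R -> (forall i, 0 <= b i) ->
    \esum_(i in D) (r%:E * b i) <= r%:E * \esum_(i in D) b i.
  move=> r0 b0; apply: ge_ereal_sup => _ [X [finX XD] <-].
  rewrite -ge0_mule_fsumr// lee_wpmul2l ?lee_fin//.
  by apply: esum_ge; exists X.
apply/eqP; rewrite eq_le ub//=.
have [->|cn0] := eqVneq c 0%R.
  by rewrite mul0e esum_ge0// => i _; rewrite mul0e.
have cV i : D i -> a i = c^-1%:E * (c%:E * a i).
  by rewrite muleA -EFinM mulVf// mul1e.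
rewrite [X in c%:E * X](eq_esum cV).
have := ub c^-1%R (fun i => c%:E * a i).
rewrite invr_ge0 => /(_ c0) h.
apply: (@le_trans _ _ (c%:E * (c^-1%:E * \esum_(i in D) (c%:E * a i)))).
  rewrite lee_wpmul2l ?lee_fin// h// => i.
  by rewrite mule_ge0 ?lee_fin ?a0.
by rewrite muleA -EFinM divff// mul1e.
Qed.

(** Distributivity for nonnegative series, by induction on the number of factors: the first series
    is split off and the double sum is merged into one over multi-indices. *)
Lemma prod_nneseries n (a : 'I_n -> nat -> R) (s : 'I_n -> R) :
  (forall i k, 0 <= a i k)%R ->
  (forall i, \sum_(k <oo) (a i k)%:E = (s i)%:E) ->
  (\prod_i s i)%:E =
  \esum_(j in [set: {ffun 'I_n -> nat}]) (\prod_i a i (j i))%:E.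
Proof.
elim: n a s => [|n IHn] a s a0 sE.
  pose j0 : {ffun 'I_0 -> nat} := [ffun=> 0%N].
  have -> : [set: {ffun 'I_0 -> nat}] = [set j0].
    by apply/seteqP; split => // j _; apply/ffunP => -[].
  by rewrite esum_set1 !big_ord0// lee_fin.
have p0 m (b : 'I_m -> nat -> R) (j : 'I_m -> nat) :
    (forall i k, 0 <= b i k)%R -> 0 <= (\prod_i b i (j i))%:E.
  by move=> b0; rewrite lee_fin prodr_ge0.
(* The bijection that puts a first entry in front of a shorter multi-index. *)
pose e (p : nat * {ffun 'I_n -> nat}) : {ffun 'I_n.+1 -> nat} :=
  [ffun i => if unlift ord0 i is Some i' then p.2 i' else p.1].
have e0 p : e p ord0 = p.1 by rewrite ffunE unlift_none.
have eS p i : e p (lift ord0 i) = p.2 i by rewrite ffunE liftK.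
rewrite (reindex_esum ([set: nat] `*`` (fun=> [set: {ffun 'I_n -> nat}])) _ e).
  rewrite -(@esum_esum _ _ _ _ _ (fun k j => (\prod_i a i (e (k, j) i))%:E)).
    rewrite big_ord_recl EFinM muleC -sE -nneseriesZl//; last first.
      by move=> k _; rewrite lee_fin.
    rewrite nneseries_esumT; last first.
      by move=> k; rewrite -EFinM lee_fin mulr_ge0// prodr_ge0// => i _;
        rewrite -lee_fin -sE nneseries_ge0// => k' _ _; rewrite lee_fin.
    apply: eq_esum => k _.
    rewrite muleC (IHn (fun i => a (lift ord0 i)))//.
    rewrite -ge0_esumZl//; last first.
      by move=> j; exact: (p0 _ (fun i => a (lift ord0 i))).
    apply: eq_esum => j _; rewrite -EFinM big_ord_recl e0.
    by congr (_ * _)%:E; apply: eq_bigr => i _; rewrite eS.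
  by move=> k j _ _; exact: (p0 _ a (e (k, j))).
split => //=.
- by move=> [k j] [k' j'] _ _ ekj; congr pair;
    [have := congr1 (fun f : {ffun _} => f ord0) ekj; rewrite !e0|
     apply/ffunP => i; have := congr1 (fun f : {ffun _} => f (lift ord0 i)) ekj;
     rewrite !eS].
- move=> j _; exists (j ord0, [ffun i => j (lift ord0 i)]) => //.
  by apply/ffunP => i; rewrite ffunE; case: unliftP => [i'|] ->; rewrite ?ffunE.
Qed.

End esum_product.

(** * The conditional density *)

Section density.
Context d (T : measurableType d) (R : realType).
Local Open Scope ereal_scope.

Lemma probability_of_density (m : {measure set T -> \bar R})
    (f : T -> \bar R) :
  measurable_fun setT f -> (forall x, 0 <= f x) -> \int[m]_x f x = 1 ->
  exists P : probability T R, forall A, P A = \int[m]_(x in A) f x.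
Proof.
move=> mf f0 f1; pose nu A := \int[m]_(x in A) f x.
have nu0 : nu set0 = 0 by rewrite /nu integral_set0.
have nu_ge0 A : 0 <= nu A by exact: integral_ge0.
have nu_additive : semi_sigma_additive nu.
  move=> F mF tF mUF; rewrite /nu; apply: cvg_toP.
    apply: ereal_nondecreasing_is_cvgn => i j ij.
    by apply: lee_sum_nneg_natr => // k _ _; exact: integral_ge0.
  by rewrite ge0_integral_bigcup//; exact: measurable_funTS.
pose nuM : measure T R :=
  HB.pack nu (isMeasure.Build _ _ _ nu nu0 nu_ge0 nu_additive).
pose nuP : probability T R :=
  HB.pack (Measure.sort nuM) (@Measure_isProbability.Build _ _ _ nuM f1).
by exists nuP.
Qed.

End density.

(** * Densities in barycentric coordinates *)

Section conditional_density.
Context {R : realType}.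
Implicit Types a l y : R.

(** The identity holds term by term: the power [2^(a+i)] in the chi-squared density contributes
    [2^i], which turns [(l/2)^i] into [(l/4)^i]. *)
Lemma ncchi2_pdfE a l y : 0 < a -> 0 <= l -> 0 < y ->
  ncchi2_pdf (2 * a) l y =
  expR (- (l / 2)) / 2 `^ a * expR (- (y / 2)) * ncgpow a (l / 4) y.
Proof.
move=> a0 l0 y0.
have ly0 : 0 <= l / 4 * y by rewrite mulr_ge0 ?(ltW y0)// divr_ge0.
pose u i := (ascending_factorial a i)^-1 * ((l / 4 * y) ^+ i / i`!%:R).
pose C := expR (- (l / 2)) / 2 `^ a * expR (- (y / 2)) * gpow a y.
transitivity (limn (series (C *: u))); last first.
  rewrite lim_seriesZ; last exact: is_cvg_series_hyp0F1.
  by rewrite /ncgpow mulrA.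
congr (limn (series _)); apply/funext => i /=.
rewrite -[(C *: u) i]/(C * u i) /C /u /gpow /ascending_factorial pospowE//.
have -> : (2 * a + 2 * i%:R) / 2 = a + i%:R by field.
have -> : y `^ (a + i%:R - 1) = y `^ (a - 1) * y ^+ i.
  rewrite -powR_mulrn ?(ltW y0)// -powRD ?(gt_eqF y0) ?implybT//.
  by congr (_ `^ _); ring.
have -> : 2 `^ (a + i%:R) = 2 `^ a * 2 ^+ i :> R.
  by rewrite powRD ?pnatr_eq0 ?implybT// powR_mulrn.
have -> : (l / 4 * y) ^+ i = (l / 2) ^+ i * (y ^+ i / 2 ^+ i).
  by rewrite -expr_div_n -exprMn; congr (_ ^+ _); field.
have G0 := lt0r_neq0 (Gamma_gt0 a0).
have Gi0 : Gamma (a + i%:R) != 0.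
  by apply: lt0r_neq0; apply: Gamma_gt0; rewrite ltr_wpDr.
have p0 : 2 `^ a != 0 :> R by rewrite lt0r_neq0// powR_gt0.
have q0 : 2 ^+ i != 0 :> R by rewrite expf_neq0.
have f0 : i`!%:R != 0 :> R by rewrite pnatr_eq0 -lt0n fact_gt0.
(* Once these values are abstract nonzero numbers, a rational identity remains. *)
move: (Gamma a) (Gamma (a + i%:R)) (2 `^ a) (2 ^+ i) (i`!%:R) G0 Gi0 p0 q0 f0.
move=> G Gi p q f G0 Gi0 p0 q0 f0.
by field; rewrite G0 Gi0 p0 q0 f0.
Qed.

Context {D : nat}.
Implicit Types (alpha lambda : 'I_D.+1 -> R) (x : D.-tuple R).

(** Treating the last coordinate on a par with the others turns each product with a separate last
    factor into a single product over ['I_D.+1]. *)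
Definition barycentric x (i : 'I_D.+1) : R :=
  if unlift ord_max i is Some j then tnth x j else last_coord x.

Lemma barycentric_init x (i : 'I_D) : barycentric x (init_ord i) = tnth x i.
Proof.
rewrite /barycentric (_ : init_ord i = lift ord_max i) ?liftK//.
by apply: val_inj; rewrite /= /bump leqNgt ltn_ord.
Qed.

Lemma barycentric_last x : barycentric x ord_max = last_coord x.
Proof. by rewrite /barycentric unlift_none. Qed.

Lemma barycentric_gt0 x i : simplex x -> 0 < barycentric x i.
Proof.
move=> [x0 x1]; rewrite /barycentric; case: unlift => [j|].
  by have /andP[] := x0 j.
by rewrite subr_gt0.
Qed.

Lemma prod_barycentric (F : 'I_D.+1 -> R -> R) x :
  \prod_i F i (barycentric x i) =
  (\prod_(i < D) F (init_ord i) (tnth x i)) * F ord_max (last_coord x).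
Proof.
rewrite big_ord_recr /= barycentric_last; congr (_ * _).
apply: eq_bigr => i _.
by rewrite -[widen_ord _ _]/(init_ord i) barycentric_init.
Qed.

Lemma sum_barycentric x : \sum_i barycentric x i = 1.
Proof.
rewrite big_ord_recr /= barycentric_last.
under eq_bigr => i _ do rewrite -[widen_ord _ _]/(init_ord i) barycentric_init.
by rewrite /last_coord addrC subrK.
Qed.

Lemma simplex_kernelE alpha lambda x :
  simplex_kernel alpha lambda 1 x =
  \prod_i ncgpow (alpha i) (lambda i) (barycentric x i).
Proof.
by rewrite (prod_barycentric (fun i => ncgpow (alpha i) (lambda i))).
Qed.

(** Off the simplex some barycentric coordinate is nonpositive, since positivity of all of them
    forces each to be below 1. Integrals over the simplex thus extend to the whole space. *)
Lemma simplex_kernel_eq0 alpha lambda x :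
  ~ simplex x -> simplex_kernel alpha lambda 1 x = 0.
Proof.
move=> nSx; rewrite simplex_kernelE.
have [[i xi]|h] := pselect (exists i, barycentric x i <= 0).
  by rewrite (bigD1 i)//= ncgpow_le0// mul0r.
have x0 i : 0 < barycentric x i.
  by rewrite ltNge; apply/negP => ?; apply: h; exists i.
have s1 : \sum_(i < D) tnth x i < 1.
  by have := x0 ord_max; rewrite barycentric_last subr_gt0.
exfalso; apply: nSx; split=> // i.
have x0' j : 0 < tnth x j by rewrite -barycentric_init.
rewrite x0' (le_lt_trans _ s1)// (bigD1 i)//= lerDl sumr_ge0// => j _.
exact/ltW.
Qed.

Lemma CNcDir_kernelE alpha lambda x :
  (forall i, 0 < alpha i) -> (forall i, 0 <= lambda i) -> simplex x ->
  CNcDir_kernel alpha lambda x =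
  (\prod_i (expR (- (lambda i / 2)) / 2 `^ alpha i)) * expR (- (1 / 2)) *
  simplex_kernel alpha (fun i => lambda i / 4) 1 x.
Proof.
move=> a0 l0 Sx.
rewrite /CNcDir_kernel.
rewrite -(prod_barycentric (fun i => ncchi2_pdf (2 * alpha i) (lambda i))).
under eq_bigr => i _ do rewrite ncchi2_pdfE ?barycentric_gt0//.
(* The coordinates sum to 1, so the exponential factors multiply to the constant
   [expR (- (1 / 2))]. *)
rewrite simplex_kernelE 2!big_split /=; congr (_ * _ * _); rewrite -expR_sum.
by rewrite sumrN -mulr_suml sum_barycentric.
Qed.

Lemma dirichlet_pdfE alpha x : simplex x -> (forall i, 0 < alpha i) ->
  dirichlet_pdf alpha x =
  Gamma (\sum_i alpha i) * \prod_i gpow (alpha i) (barycentric x i).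
Proof.
move=> Sx a0; rewrite /dirichlet_pdf -!mulrA; congr (_ * _).
rewrite -(prod_barycentric (fun i y => y `^ (alpha i - 1))).
rewrite mulrC -prodfV -big_split /=.
by apply: eq_bigr => i _; rewrite /gpow pospowE ?barycentric_gt0.
Qed.

End conditional_density.

(** * Normalization, mixture form and product form *)

Section CNcDir_density.
Context {R : realType} {D : nat}.
Local Notation T := (measurableTypeR R).
Variables alpha lambda : 'I_D.+1 -> R.
Hypothesis alpha_gt0 : forall i, 0 < alpha i.
Hypothesis lambda_ge0 : forall i, 0 <= lambda i.
Implicit Types x : D.-tuple R.

Let lambda4 i := lambda i / 4.

Let lambda4_ge0 i : 0 <= lambda4 i.
Proof. by rewrite divr_ge0. Qed.

Let sum_alpha_gt0 : 0 < \sum_i alpha i.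
Proof.
by rewrite big_ord_recl ltr_wpDr// sumr_ge0// => i _; exact/ltW.
Qed.

Let kernel x := simplex_kernel alpha lambda4 1 x.

Let kernel_ge0 x : 0 <= kernel x.
Proof. exact: simplex_kernel_ge0. Qed.

(** The total integral of [kernel], by [integral_simplex_kernel] at [s = 1]. *)
Let mass := ncgpow (\sum_i alpha i) (\sum_i lambda4 i) 1.

Let massE : mass =
  hyp0F1 (\sum_i alpha i) ((\sum_i lambda i) / 4) / Gamma (\sum_i alpha i).
Proof.
by rewrite /mass /ncgpow /gpow pospowE// powR1 mul1r mulr1 -mulr_suml mulrC.
Qed.

Let mass_gt0 : 0 < mass.
Proof. by rewrite ncgpow_gt0// sumr_ge0. Qed.

(** The constant [K] occurs in the kernel and in its integral, and cancels. That integral is the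
    positive real [K * mass], so [fine] returns its true value. *)
Lemma CNcDir_pdfE x : simplex x ->
  CNcDir_pdf alpha lambda x = kernel x / mass.
Proof.
move=> Sx.
pose K := (\prod_i (expR (- (lambda i / 2)) / 2 `^ alpha i)) * expR (- (1 / 2)).
have K0 : 0 < K.
  rewrite mulr_gt0 ?expR_gt0// prodr_gt0// => i _.
  by rewrite divr_gt0 ?expR_gt0 ?powR_gt0.
rewrite /CNcDir_pdf CNcDir_kernelE// -/K.
have -> : (\int[lebesgue_tuple R D]_(z in simplex)
    (CNcDir_kernel alpha lambda z)%:E = (K * mass)%:E)%E.
  rewrite integral_mkcond EFinM /mass -integral_simplex_kernel//.
  rewrite -ge0_integralZl//.
  - apply: eq_integral => z _; rewrite patchE -EFinM.
    case: ifPn => [|/negP nSz].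
      by rewrite inE => Sz; rewrite CNcDir_kernelE.
    by rewrite simplex_kernel_eq0 ?mulr0// => Sz; apply: nSz; rewrite inE.
  - by apply/measurable_EFinP; exact: measurable_simplex_kernel.
  - by move=> z _; rewrite lee_fin kernel_ge0.
  - by rewrite lee_fin ltW.
by rewrite /= -mulf_div divff ?mul1r// lt0r_neq0.
Qed.

Lemma CNcDirE (A : set (D.-tuple T)) :
  CNcDir alpha lambda A =
  (\int[lebesgue_tuple R D]_(x in A) (kernel x / mass)%:E)%E.
Proof.
rewrite /CNcDir integral_mkcondr; apply: eq_integral => x _; rewrite patchE.
case: ifPn => [|/negP nSx]; first by rewrite inE => Sx; rewrite CNcDir_pdfE.
rewrite /kernel simplex_kernel_eq0 ?mul0r// => Sx.
by apply: nSx; rewrite inE.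
Qed.

Lemma CNcDir_probability :
  exists P : probability (D.-tuple T) R, forall A, P A = CNcDir alpha lambda A.
Proof.
have mk : measurable_fun setT (fun x : D.-tuple T => (kernel x / mass)%:E).
  apply/measurable_EFinP; apply: measurable_funM => //.
  exact: measurable_simplex_kernel.
have k0 x : (0 <= (kernel x / mass)%:E)%E by rewrite lee_fin divr_ge0// ltW.
have k1 : (\int[lebesgue_tuple R D]_x (kernel x / mass)%:E = 1)%E.
  under eq_integral do rewrite mulrC EFinM.
  rewrite ge0_integralZl//.
  - rewrite integral_simplex_kernel// -EFinM mulVf//.
    exact: lt0r_neq0 mass_gt0.
  - by apply/measurable_EFinP; exact: measurable_simplex_kernel.
  - by move=> z _; rewrite lee_fin kernel_ge0.
  - by rewrite lee_fin invr_ge0 ltW.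
have [P PE] := probability_of_density mk k0 k1.
by exists P => A; rewrite PE CNcDirE.
Qed.

(** The product of the series of the [ncgpow] factors is expanded over multi-indices, and [mass^-1]
    is distributed over the sum. *)
Lemma CNcDir_pdf_mixture x : simplex x ->
  (CNcDir_pdf alpha lambda x)%:E = CNcDir_mixture alpha lambda x.
Proof.
move=> Sx; rewrite CNcDir_pdfE// /CNcDir_mixture /kernel simplex_kernelE.
pose t i k := lambda4 i ^+ k / k`!%:R * gpow (alpha i + k%:R) (barycentric x i).
have t0 i k : 0 <= t i k.
  by rewrite mulr_ge0 ?gpow_ge0 ?divr_ge0 ?exprn_ge0// ltr_wpDr.
rewrite mulrC EFinM (@prod_nneseries _ _ t)//; last first.
  by move=> i; rewrite -ncgpow_series.
rewrite -ge0_esumZl; last 2 first.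
- by rewrite invr_ge0 ltW.
- by move=> j; rewrite lee_fin prodr_ge0.
apply: eq_esum => j _; rewrite -EFinM; congr EFin.
rewrite dirichlet_pdfE//; last by move=> i; rewrite ltr_wpDr.
have -> : \sum_i (alpha i + (j i)%:R) = \sum_i alpha i + (\sum_i j i)%N%:R.
  by rewrite big_split natr_sum.
rewrite /t big_split /= massE /CNcDir_weight /ascending_factorial !invf_div.
have Aj0 : Gamma (\sum_i alpha i + (\sum_i j i)%N%:R) != 0.
  by apply: lt0r_neq0; apply: Gamma_gt0; rewrite ltr_wpDr.
set p := \prod_i _; set q := \prod_i _; set h := hyp0F1 _ _.
set GA := Gamma (\sum_i alpha i); set Gj := Gamma _.
rewrite (mulrC GA) -[RHS]mulrA -!mulrA; do 2 congr (_ * _).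
(* The factor [Gj] of the Dirichlet density cancels the one in the inverse ascending factorial; what
   is left in front is [mass^-1]. *)
by rewrite (mulrCA p) mulKf.
Qed.

(** Each [ncgpow] splits into its two factors: the [gpow] parts, with the Gamma factor of [mass^-1],
    form the Dirichlet density. *)
Lemma CNcDir_pdf_hyp0F1 x : simplex x ->
  CNcDir_pdf alpha lambda x =
  dirichlet_pdf alpha x *
  ((\prod_(i < D) hyp0F1 (alpha (init_ord i))
                    (lambda (init_ord i) / 4 * tnth x i)) *
   hyp0F1 (alpha ord_max)
          (lambda ord_max / 4 * (1 - \sum_(i < D) tnth x i)) /
   hyp0F1 (\sum_i alpha i) ((\sum_i lambda i) / 4)).
Proof.
move=> Sx; rewrite CNcDir_pdfE// dirichlet_pdfE//.
rewrite -(prod_barycentric (fun i y => hyp0F1 (alpha i) (lambda i / 4 * y))).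
rewrite /kernel simplex_kernelE massE invf_div /ncgpow big_split /=.
set h := hyp0F1 (\sum_i _) _; set G := Gamma _.
by rewrite mulrACA [G * _]mulrC.
Qed.

End CNcDir_density.

Theorem mainTheorem1 (R : realType) (D : nat) (hD : (1 <= D)%N)
    (alpha lambda : 'I_D.+1 -> R)
    (halpha : forall i, 0 < alpha i) (hlambda : forall i, 0 <= lambda i) :
  [/\ (* the distribution is well defined *)
      (exists P : probability (D.-tuple (measurableTypeR R)) R,
        forall A, measurable A -> P A = CNcDir alpha lambda A),
      (* the mixture is a density of it *)
      (forall A : set (D.-tuple (measurableTypeR R)), measurable A ->
        CNcDir alpha lambda A =
        (\int[lebesgue_tuple R D]_(x in A `&` simplex)
           CNcDir_mixture alpha lambda x)%E),
      (forall x : D.-tuple R, simplex x ->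
        (CNcDir_pdf alpha lambda x)%:E = CNcDir_mixture alpha lambda x)
    & (forall x : D.-tuple R, simplex x ->
        CNcDir_pdf alpha lambda x =
        dirichlet_pdf alpha x *
        ((\prod_(i < D) hyp0F1 (alpha (init_ord i))
                          (lambda (init_ord i) / 4 * tnth x i)) *
         hyp0F1 (alpha ord_max)
                (lambda ord_max / 4 * (1 - \sum_(i < D) tnth x i)) /
         hyp0F1 (\sum_i alpha i) ((\sum_i lambda i) / 4)))].
Proof.
split.
- have [P PE] := CNcDir_probability halpha hlambda.
  by exists P => A _; exact: PE.
- move=> A _; apply: eq_integral => x; rewrite inE => -[_ Sx].
  exact: CNcDir_pdf_mixture.
- by move=> x; exact: CNcDir_pdf_mixture.
- by move=> x; exact: CNcDir_pdf_hyp0F1.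
Qed.
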